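(* Let $R$ be a weakly Laskerian ring of finite Krull dimension. Then $\operatorname{Spec} R$ (with the Zariski topology) is a Noetherian topological space. In particular, if $X_1,\dots,X_n$ are $n$ indeterminates over $R$, then $\operatorname{Spec} R[X_1,\dots,X_n]$ is Noetherian.
   Context: All rings are commutative with identity. For an $R$-module $M$, $\operatorname{Ass}_R M$ denotes the set of prime ideals $\mathfrak p$ of $R$ of the form $\mathfrak p=(0:_R x)$ for some $x\in M$. An $R$-module $M$ is weakly Laskerian if $\operatorname{Ass}_R(M/N)$ is a finite set for every submodule $N$ of $M$. A ring is weakly Laskerian if it is weakly Laskerian as a module over itself. A topological space is Noetherian if every ascending chain of open sets eventually stabilizes. *)

(* Defs.v *)
From HB Require Import structures.
From mathcomp Require Import all_boot all_order all_algebra.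
From mathcomp Require Import boolp classical_sets functions cardinality.
From mathcomp Require Import topology.

Set Implicit Arguments.
Unset Strict Implicit.
Unset Printing Implicit Defensive.

Import GRing.Theory.
Local Open Scope classical_set_scope.
Local Open Scope ring_scope.

(* The library has no quotient of a module by a submodule: the scalar action is
   added here to its quotient group. *)
Section QuotientModule.
Variables (R : nzRingType) (M : lmodType R) (N : submodClosed M).

Fact submod_zmod_closed : zmod_closed N.
Proof.
split=> [|x y xN yN]; first exact: rpred0.
by rewrite rpredD // -scaleN1r rpredZ.
Qed.

Definition submod_zmod : zmodClosed M :=
  HB.pack_for (zmodClosed M) (N : {pred M})
    (GRing.isZmodClosed.Build M (N : {pred M}) submod_zmod_closed).

Definition quot_mod : Type := Quotient.quot submod_zmod.
HB.instance Definition _ := GRing.Zmodule.on quot_mod.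

Definition pi_mod (x : M) : quot_mod :=
  (\pi_(Quotient.quot submod_zmod) x)%qT.

Definition repr_mod (u : quot_mod) : M := repr (u : Quotient.quot submod_zmod).

Definition scale_mod (a : R) (u : quot_mod) : quot_mod :=
  pi_mod (a *: repr_mod u).

Lemma pi_modE x y : pi_mod x = pi_mod y <-> x - y \in N.
Proof.
rewrite -[x - y \in N]/(x - y \in submod_zmod) Quotient.idealrBE.
by split=> [/eqP|/eqP].
Qed.

Lemma repr_modK u : pi_mod (repr_mod u) = u.
Proof. exact: reprK. Qed.

Lemma pi_modD x y : pi_mod (x + y) = pi_mod x + pi_mod y.
Proof. exact: (raddfD (\pi_(Quotient.quot submod_zmod))%qT). Qed.

Lemma pi_modZ a x : pi_mod (a *: x) = scale_mod a (pi_mod x).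
Proof.
apply/pi_modE; rewrite -scalerBr rpredZ //.
by apply/pi_modE; rewrite repr_modK.
Qed.

Fact scale_modA a b u : scale_mod a (scale_mod b u) = scale_mod (a * b) u.
Proof. by rewrite -[u]repr_modK -!pi_modZ scalerA. Qed.

Fact scale_mod1 : left_id 1 scale_mod.
Proof. by move=> u; rewrite -[u]repr_modK -pi_modZ scale1r. Qed.

Fact scale_modDr : right_distributive scale_mod +%R.
Proof.
move=> a u v; rewrite -[u]repr_modK -[v]repr_modK.
by rewrite -pi_modD -!pi_modZ scalerDr pi_modD.
Qed.

Fact scale_modDl u : {morph scale_mod^~ u : a b / a + b}.
Proof. by move=> a b; rewrite -[u]repr_modK -!pi_modZ scalerDl pi_modD. Qed.

HB.instance Definition _ := GRing.Zmodule_isLmodule.Build R quot_mod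
  scale_modA scale_mod1 scale_modDr scale_modDl.

End QuotientModule.

(* Elements of [prime_idealr R] are the proper prime ideals of [R]; by [spec_eqP]
   they are determined by their underlying sets. *)
Definition spec (R : comNzRingType) : Type := prime_idealr R.

Section Spec.
Variable R : comNzRingType.

Coercion spec_pred (p : spec R) : {pred R} := (p : prime_idealr R).

Lemma spec_eqP (p q : spec R) : p =i q <-> p = q.
Proof.
split=> [|-> //]; case: p q => [p [[p1] [p2] [p3] [p4]]].
case=> [q [[q1] [q2] [q3] [q4]]] /= e.
have {e} epq : p = q by apply/funext => x; exact: e x.
case: _ / epq in q1 q2 q3 q4 *.
by rewrite (Prop_irrelevance p1 q1) (Prop_irrelevance p2 q2)
  (Prop_irrelevance p3 q3) (Prop_irrelevance p4 q4).
Qed.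

HB.instance Definition _ := gen_eqMixin (spec R).
HB.instance Definition _ := gen_choiceMixin (spec R).

Definition zariski_closed (E : set R) : set (spec R) :=
  [set p : spec R | forall x, E x -> x \in p].

Definition zariski_open : set_system (spec R) :=
  [set U | exists E : set R, U = ~` zariski_closed E].

Fact zariski_openT : zariski_open setT.
Proof.
exists setT; rewrite eqEsubset; split=> // p _ pT.
by have := pT 1 I; rewrite (idealr1 (p : prime_idealr R)).
Qed.

Fact zariski_openI : setI_closed zariski_open.
Proof.
move=> _ _ [E ->] [F ->]; exists [set z | exists x y, [/\ E x, F y & z = x * y]].
rewrite -setCU; congr (~` _); rewrite eqEsubset; split=> p.
  case=> hp _ [x [y [Ex Fy ->]]]; rewrite (prime_idealrM (p : prime_idealr R)).
    by apply/orP; left; exact: hp.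
  by apply/orP; right; exact: hp.
move=> hp; apply: contrapT => /not_orP[+ nF]; apply=> x Ex.
apply: contrapT => /negP npx; apply: nF => y Fy.
have := hp (x * y); rewrite (prime_idealrM (p : prime_idealr R)) => /(_ _)/orP[].
- by exists x, y.
- by move=> px; rewrite -[_ \in _]/(x \in p) px in npx.
- by [].
Qed.

Fact zariski_open_bigU (I : Type) (f : I -> set (spec R)) :
  (forall i, zariski_open (f i)) -> zariski_open (\bigcup_i f i).
Proof.
move=> /choice[E fE]; exists (\bigcup_i E i).
rewrite eqEsubset; split=> [p [i _]|p /= hp].
  by rewrite fE => /= nEp hp; apply: nEp => x Ex; apply: hp; exists i.
apply: contrapT => nU; apply: hp => x [i _ Ex].
apply: contrapT => npx; apply: nU; exists i => //; rewrite fE => hp.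
exact/npx/hp.
Qed.

HB.instance Definition _ := isOpenTopological.Build (spec R)
  zariski_openT zariski_openI zariski_open_bigU.

End Spec.

Definition noetherian_space (T : topologicalType) : Prop :=
  forall U : nat -> set T,
    (forall i, open (U i)) -> (forall i, U i `<=` U i.+1) ->
    exists m, forall i, (m <= i)%N -> U i = U m.

(* [(0 :_R x)] *)
Definition annihilator (R : comNzRingType) (M : lmodType R) (x : M) : {pred R} :=
  [pred a : R | a *: x == 0].

Definition associated_primes (R : comNzRingType) (M : lmodType R) :
    set (spec R) :=
  [set p | exists x : M, p =i annihilator x].

Definition weakly_laskerian (R : comNzRingType) (M : lmodType R) : Prop :=
  forall N : submodClosed M, finite_set (associated_primes (quot_mod N)).

(* [R^o] is [R] as a module over itself. *)
Definition weakly_laskerian_ring (R : comNzRingType) : Prop :=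
  weakly_laskerian R^o.

(* [p 0 < p 1 < ... < p l], a chain of length [l] *)
Definition prime_chain (R : comNzRingType) (l : nat) (p : 'I_l.+1 -> spec R) :=
  forall i j : 'I_l.+1, (i < j)%N ->
    {subset p i <= p j} /\ ~ {subset p j <= p i}.

Definition finite_krull_dim (R : comNzRingType) : Prop :=
  exists d : nat, forall (l : nat) (p : 'I_l.+1 -> spec R),
    prime_chain p -> (l <= d)%N.

(* Main.v *)
(* Suppose that the ideal [I] is the intersection of infinitely many primes that
   are minimal over it. The space of these primes is Hausdorff and infinite, hence
   contains a sequence [p n] with pairwise disjoint basic neighbourhoods, cut out by
   elements [x n]: [x n] is not in [p n] and [x m * x n \in I] for [m <> n]. Then
   [p n] is the annihilator of [x n] modulo [I + \sum_n x n * p n], so that this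
   quotient has infinitely many associated primes. Over a weakly Laskerian ring
   every closed subset of the spectrum is thus a finite union of irreducible closed
   sets [V(p)]. If the dimension is finite, induction on the coheight of [p] shows
   that the closed subsets of [V(p)] are cut out by finitely many elements, and
   the spectrum is Noetherian. The passage to polynomials is Hilbert's basis
   argument up to radicals. *)
Require Import Defs.
From HB Require Import structures.
From mathcomp Require Import all_boot all_order all_algebra.
From mathcomp Require Import boolp classical_sets functions cardinality.
From mathcomp Require Import topology.
(* The notations of mpoly clash with those of mathcomp-analysis;
   [mpoly n R] is the polynomial ring in [n] indeterminates over [R]. *)
From mathcomp Require Import -(notations) mpoly.

Set Implicit Arguments.
Unset Strict Implicit.
Unset Printing Implicit Defensive.

Import GRing.Theory.
Local Open Scope classical_set_scope.
Local Open Scope ring_scope.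

(** * Zorn's lemma, sequences and induction *)

Lemma chain_seq_sub (T : eqType) (F : set (set T)) (s : seq T) :
  F !=set0 -> total_on F subset -> [set` s] `<=` \bigcup_(X in F) X ->
  exists2 X, F X & [set` s] `<=` X.
Proof.
move=> [X0 FX0] Ftot; elim: s => [_|x s IH sF]; first by exists X0.
have [|X FX sX] := IH; first by move=> y ys; apply: sF; rewrite /= inE ys orbT.
have [Y FY Yx] : (\bigcup_(X in F) X) x by apply: sF; rewrite /= inE eqxx.
have [XY|YX] := Ftot X Y FX FY.
  by exists Y => // y /=; rewrite inE => /predU1P[->//|/sX/XY].
by exists X => // y /=; rewrite inE => /predU1P[->|/sX//]; exact: YX.
Qed.

(** Zorn's lemma is applied to the sets whose union with [E] satisfies [P]; the empty chain is then
    covered by [P E]. *)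
Lemma Zorn_above T (P : set (set T)) (E : set T) : P E ->
  (forall F, F `<=` P -> F !=set0 -> total_on F subset ->
    P (\bigcup_(X in F) X)) ->
  exists A, [/\ E `<=` A, P A & forall B, A `<` B -> ~ P B].
Proof.
move=> PE chainP; have [F FP Ftot|A [PA maxA]] :=
  @Zorn_bigcup T [set X | P (E `|` X)].
  have [->|/set0P[X0 FX0]] := eqVneq F set0.
    by rewrite /= bigcup_set0 setU0.
  rewrite /=; have -> : E `|` \bigcup_(X in F) X =
      \bigcup_(Y in [set E `|` X | X in F]) Y.
    rewrite bigcup_image eqEsubset; split=> [x [Ex|[X FX Xx]]|x [X FX [Ex|Xx]]].
    - by exists X0 => //; left.
    - by exists X => //; right.
    - by left.
    - by right; exists X.
  apply: chainP.
  - by move=> _ [X FX <-]; exact: FP.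
  - by exists (E `|` X0), X0.
  - move=> _ _ [X FX <-] [Y FY <-].
    by have [XY|YX] := Ftot X Y FX FY; [left|right]; exact: setUS.
have EA : E `<=` A.
  apply: contrapT => nEA; apply: (maxA (E `|` A)); last by rewrite /= setUA setUid.
  split; first exact: subsetUr.
  by move=> EAA; apply: nEA; apply: subset_trans EAA; exact: subsetUl.
exists A; split=> // [|B AB PB].
  by rewrite -(setUidr EA).
apply: (maxA _ AB); rewrite /= setUidr //.
exact: subset_trans EA (properW AB).
Qed.

Lemma infinite_set_seq T (A : set T) : infinite_set A ->
  exists f : nat -> T, injective f /\ forall n, A (f n).
Proof.
elim/Ppointed: T => T in A *; first by rewrite emptyE_subdef => /infinite_setN0[].
move=> /infiniteP/pcard_leP[f]; exists f; split=> [m n|n]; last exact: funS.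
by apply: (@inj _ _ _ f); rewrite inE.
Qed.

(** By choice, a failure of [P] would continue to an infinite [r]-sequence of failures. *)
Lemma no_sequence_ind T (r : T -> T -> Prop) :
  (forall f : nat -> T, ~ forall n, r (f n) (f n.+1)) ->
  forall P : T -> Prop, (forall x, (forall y, r x y -> P y) -> P x) ->
  forall x, P x.
Proof.
move=> nor P IH x; apply: contrapT => nPx.
have /choice[g gP] : forall y, exists z, ~ P y -> r y z /\ ~ P z.
  move=> y; have [Py|nPy] := pselect (P y); first by exists y.
  apply: contrapT => nz; apply/nPy/IH => z ryz.
  by apply: contrapT => nPz; apply: nz; exists z.
have nPit n : ~ P (iter n g x) by elim: n => //= n /gP[].
by apply: (nor (fun n => iter n g x)) => n; have [] := gP _ (nPit n).
Qed.

(** * Prime ideals and multiplicative sets *)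

Section PrimeIdeals.
Variable R : comNzRingType.
Implicit Types (p q : spec R) (E : set R) (x y a : R) (s : seq R).

Lemma ex_spec (P : set R) :
  P 0 -> ~ P 1 -> (forall x y, P x -> P y -> P (x + y)) ->
  (forall a x, P x -> P (a * x)) -> (forall x y, P (x * y) -> P x \/ P y) ->
  exists p, forall x, x \in p <-> P x.
Proof.
move=> P0 P1 PD PM Pprime; pose S x := `[< P x >].
have SI : idealr_closed S.
  split=> [|| a x y]; rewrite -?topredE /= /S; first exact/asboolP.
    exact/asboolP.
  by move=> /asboolP Px /asboolP Py; apply/asboolP/PD => //; exact: PM.
have SP : prime_idealr_closed S.
  by move=> x y /asboolP/Pprime[] Pxy; apply/orP; [left|right]; exact/asboolP.
pose p : prime_idealr R := HB.pack_for (prime_idealr R) S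
  (isIdealr.Build R S SI) (isPrimeIdealrClosed.Build R S SP).
by exists p => x; split=> /asboolP.
Qed.

Lemma spec0 p : 0 \in p.
Proof. exact: idealr0 (p : prime_idealr R). Qed.

Lemma spec1 p : 1 \notin p.
Proof. by apply/negP; rewrite (idealr1 (p : prime_idealr R)). Qed.

Lemma specD p x y : x \in p -> y \in p -> x + y \in p.
Proof. exact: (@rpredD _ (p : prime_idealr R)). Qed.

Lemma specB p x y : x \in p -> y \in p -> x - y \in p.
Proof. exact: (@rpredB _ (p : prime_idealr R)). Qed.

Lemma specMl p a x : x \in p -> a * x \in p.
Proof. exact: (@idealMr _ (p : prime_idealr R)). Qed.

Lemma specMr p a x : x \in p -> x * a \in p.
Proof. by rewrite mulrC; exact: specMl. Qed.

Lemma specM p x y : (x * y \in p) = (x \in p) || (y \in p).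
Proof. exact: (prime_idealrM (p : prime_idealr R)). Qed.

Lemma spec_sum p (I : Type) (r : seq I) (P : pred I) (F : I -> R) :
  (forall i, P i -> F i \in p) -> \sum_(i <- r | P i) F i \in p.
Proof. exact: (@rpred_sum _ (p : prime_idealr R)). Qed.

(** Krull's separation lemma: an ideal maximal among those that contain [I] and miss the
    multiplicative set [S] is prime. *)
Lemma prime_avoidance (I S : set R) :
  I 0 -> (forall x y, I x -> I y -> I (x + y)) ->
  (forall a x, I x -> I (a * x)) ->
  S 1 -> (forall x y, S x -> S y -> S (x * y)) ->
  (forall x, I x -> ~ S x) ->
  exists p, (forall x, I x -> x \in p) /\ (forall x, x \in p -> ~ S x).
Proof.
move=> I0 ID IM S1 SM IS.
pose good (A : set R) := [/\ A 0, forall x y, A x -> A y -> A (x + y),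
  forall a x, A x -> A (a * x) & forall x, A x -> ~ S x].
have [|F Fgood [X0 FX0] Ftot|A [IA [A0 AD AM AS] maxA]] := @Zorn_above _ good I.
- by split.
- split; first by exists X0 => //; have [] := Fgood _ FX0.
  + move=> x y [X FX Xx] [Y FY Yy].
    have [XY|YX] := Ftot X Y FX FY; [exists Y => //|exists X => //].
      by have [_ D _ _] := Fgood _ FY; apply: D => //; exact: XY.
    by have [_ D _ _] := Fgood _ FX; apply: D => //; exact: YX.
  + by move=> a x [X FX Xx]; exists X => //; have [_ _ M _] := Fgood _ FX; exact: M.
  + by move=> x [X FX Xx]; have [_ _ _ XS] := Fgood _ FX; exact: XS.
have meets x : ~ A x -> exists a b, A a /\ S (a + b * x).
  move=> nAx; apply: contrapT => nS.
  apply: (maxA [set a + b * x | a in A & b in setT]).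
    split=> [a Aa|sub]; first by exists a => //; exists 0; rewrite ?mul0r ?addr0.
    by apply/nAx/sub; exists 0 => //; exists 1; rewrite ?mul1r ?add0r.
  split.
  - by exists 0 => //; exists 0; rewrite ?mul0r ?addr0.
  - move=> _ _ [a Aa [b _ <-]] [c Ac [d _ <-]].
    by exists (a + c); [exact: AD|exists (b + d); rewrite // mulrDl addrACA].
  - move=> e _ [a Aa [b _ <-]].
    by exists (e * a); [exact: AM|exists (e * b); rewrite // mulrDr mulrA].
  - by move=> _ [a Aa [b _ <-]] Sab; apply: nS; exists a, b.
have [|||||p pA] := @ex_spec A.
- by [].
- by move=> /AS; apply.
- by [].
- by [].
- move=> x y Axy; apply: contrapT => /not_orP[/meets[a [b [Aa Sx]]]].
  move=> /meets[c [d [Ac Sy]]]; apply: (AS _ _ (SM _ _ Sx Sy)).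
  rewrite mulrDr; apply: (AD); first exact: (AM).
  rewrite mulrDl; apply: (AD); first by rewrite mulrC; exact: (AM).
  by rewrite mulrACA; exact: AM.
by exists p; split=> x; rewrite pA; [exact: IA|exact: AS].
Qed.

End PrimeIdeals.

(** * Chains of primes in finite dimension *)

Definition spec_lt (R : comNzRingType) (p q : spec R) :=
  {subset p <= q} /\ ~ {subset q <= p}.

Lemma spec_lt_trans (R : comNzRingType) (q p r : spec R) :
  spec_lt p q -> spec_lt q r -> spec_lt p r.
Proof.
move=> [pq nqp] [qr nrq]; split=> [x /pq/qr//|rp].
by apply: nrq => x /rp/pq.
Qed.

Section FiniteKrullDim.
Variable R : comNzRingType.
Hypothesis Rdim : finite_krull_dim R.

Lemma no_ascending_primes (f : nat -> spec R) :
  ~ forall n, spec_lt (f n) (f n.+1).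
Proof.
move=> fS; have [d dP] := Rdim.
suff : (d.+1 <= d)%N by rewrite ltnn.
apply: (dP d.+1 (fun i => f i)) => i j.
exact: (homo_ltn (@spec_lt_trans R) fS).
Qed.

Lemma no_descending_primes (f : nat -> spec R) :
  ~ forall n, spec_lt (f n.+1) (f n).
Proof.
move=> fS; have [d dP] := Rdim.
suff : (d.+1 <= d)%N by rewrite ltnn.
(* The first [d.+2] terms, listed backwards, form an increasing chain of length [d.+1]. *)
apply: (dP d.+1 (fun i => f (d.+1 - i)%N)) => i j ij.
have lt_desc := homo_ltn (r := fun p q => spec_lt q p)
  (fun q p r qp rq => spec_lt_trans rq qp) fS.
by apply: lt_desc; rewrite ltn_sub2l // (leq_trans ij) // -ltnS.
Qed.

End FiniteKrullDim.

(** * Finiteness of the set of minimal primes *)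

Section WeaklyLaskerian.
Variable R : comNzRingType.
Hypothesis RwL : weakly_laskerian_ring R.
Implicit Types (p q : spec R) (E : set R) (x y a : R).

(* With [I] the intersection of the [p k], the [p n] are the annihilators of the
   [x n] modulo [J = I + \sum_n x n * p n], hence an infinite set of associated
   primes; [J] is enlarged to [{a | x n * a \in I + x n ^+ 2 * p n for all n}],
   which avoids infinite sums. *)
Lemma no_orthogonal_sequence (x : nat -> R) (p : nat -> spec R) :
  (forall n, x n \notin p n) ->
  ~ (forall m n k, m <> n -> x m * x n \in p k).
Proof.
move=> xp xx.
pose J : {pred R^o} := [pred a : R | `[< forall n, exists2 b, b \in p n &
  forall k, x n * a - x n * x n * b \in p k >]].
have JP a : reflect (forall n, exists2 b, b \in p n &
    forall k, x n * a - x n * x n * b \in p k) (a \in J) by exact: asboolP.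
have Jclosed : submod_closed J.
  split.
    apply/JP => n; exists 0; first exact: spec0.
    by move=> k; rewrite !mulr0 subr0 spec0.
  move=> c a a' /JP Ja /JP Ja'; apply/JP => n.
  have [b bp bE] := Ja n; have [b' bp' bE'] := Ja' n.
  exists (c * b + b'); first by apply: specD => //; exact: specMl.
  have xE (u c' d d' e e' : R) : u * (c' * d + d') - u * u * (c' * e + e') =
      c' * (u * d - u * u * e) + (u * d' - u * u * e').
    by rewrite !mulrDr opprD addrACA mulrN !(mulrCA c').
  by move=> k; rewrite xE; apply: specD => //; exact: specMl.
pose N : submodClosed R^o := HB.pack_for (submodClosed R^o) (J : {pred R^o})
  (GRing.isSubmodClosed.Build R R^o J Jclosed).
have pi_mod0 : pi_mod N 0 = 0.
  by have := pi_modD N 0 0; rewrite addr0 -[LHS]addr0 => /addrI/esym.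
have annN n : p n =i annihilator (pi_mod N (x n)).
  move=> a; rewrite inE -[_ *: pi_mod _ _]pi_modZ -pi_mod0.
  apply/idP/eqP => [pa|/pi_modE].
    (* The witness is [a] itself at index [n], and 0 at the other indices, where orthogonality
       applies. *)
    apply/pi_modE; rewrite subr0; apply/JP => m; have [->|nm] := eqVneq m n.
      exists a => // k.
      have xE (u c : R) : u * (c * u) - u * u * c = 0.
        by rewrite mulrCA mulrC subrr.
      by rewrite xE spec0.
    exists 0 => [|k]; first exact: spec0.
    rewrite mulr0 subr0 (mulrCA (x m) a) specMl // xx //.
    exact/eqP.
  (* At index [n], the square of [x n] times [a - b] lies in [p n]; hence so do [a - b] and [a]. *)
  rewrite subr0 => /JP/(_ n)[b bp /(_ n)].
  have xE (u c d : R) : u * (c * u) - u * u * d = u * u * (c - d).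
    by rewrite mulrBr mulrCA (mulrC c).
  rewrite xE !specM (negPf (xp n)) /= => abp.
  by rewrite -(subrK b a) specD.
have pinj : injective p.
  move=> m n pmn; apply: contrapT => /(xx m n n).
  rewrite specM => /orP[xm|]; last exact/negP.
  by have := xp m; rewrite pmn xm.
case: (@infinite_nat); apply: sub_finite_set; last first.
  apply: (finite_preimage (f := p)); first by move=> ? ? _ _; exact: pinj.
  exact: (RwL N).
by move=> n _; exists (pi_mod N (x n)); exact: annN.
Qed.

Definition minimal_over E : set (spec R) :=
  [set p | zariski_closed E p /\
    forall q, zariski_closed E q -> {subset q <= p} -> q = p].

(** Otherwise the products [y * z] with [y] outside [q] and [z] outside [p] form a multiplicative
    set disjoint from the intersection of the minimal primes. A prime that contains this
    intersection and misses the products lies in both [p] and [q], hence equals both by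
    minimality. *)
Lemma minimal_over_separated E p q :
  minimal_over E p -> minimal_over E q -> p <> q ->
  exists y z, [/\ y \notin q, z \notin p &
    forall k, minimal_over E k -> y * z \in k].
Proof.
move=> [Ep minp] [Eq minq] pq; apply: contrapT => noyz.
have [||||||P [EP PS]] := @prime_avoidance R
  [set a | forall k, minimal_over E k -> a \in k]
  [set a | exists y z, [/\ y \notin q, z \notin p & a = y * z]].
- by move=> k _; exact: spec0.
- by move=> x y Ix Iy k Mk; apply: specD; [exact: Ix|exact: Iy].
- by move=> a x Ix k Mk; apply: specMl; exact: Ix.
- by exists 1, 1; rewrite mulr1; split; rewrite ?spec1.
- move=> _ _ [y [z [yq zp ->]]] [y' [z' [y'q z'p ->]]].
  exists (y * y'), (z * z'); rewrite !specM !negb_or yq zp y'q z'p.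
  by split=> //; exact: mulrACA.
- move=> x Ix [y [z [yq zp xE]]]; apply: noyz; exists y, z.
  by rewrite -xE.
have PE : zariski_closed E P by move=> x Ex; apply: EP => k [Ek _]; exact: Ek.
have Pp : {subset P <= p}.
  move=> x Px; apply: contraT => nx; case: (PS x Px).
  by exists 1, x; rewrite mul1r spec1.
have Pq : {subset P <= q}.
  move=> x Px; apply: contraT => nx; case: (PS x Px).
  by exists x, 1; rewrite mulr1 spec1.
by apply: pq; rewrite -(minp P PE Pp) (minq P PE Pq).
Qed.

(* Either every minimal prime is isolated in the subspace of minimal primes, or
   there is an accumulation point [p]; in the latter case the [x n] cut out
   pairwise disjoint open sets that approach [p]. *)
Lemma finite_minimal_over E : finite_set (minimal_over E).
Proof.
apply: contrapT => infM.
have [isol|] := pselect (forall p, minimal_over E p -> exists x,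
    x \notin p /\ forall q, minimal_over E q -> q <> p -> x \in q).
  have [f [f_inj fM]] := infinite_set_seq infM.
  have /choice[x xP] n := isol _ (fM n).
  apply: (@no_orthogonal_sequence x f) => [n|m n k mn]; first by case: (xP n).
  (* Each [f k] differs from [f m] or from [f n], and so contains [x m] or [x n]. *)
  have [->|kn] := eqVneq k n.
    by apply: specMr; apply: (xP m).2 => // /f_inj/esym.
  apply: specMl; apply: (xP n).2 => // /f_inj kn'.
  by rewrite kn' eqxx in kn.
move=> /existsNP[p /not_implyP[Mp /forallNP nisol]].
(* For [z] outside [p], [t z] consists of a minimal prime [q] other than [p] that misses [z], and of
   [y], [w] separating [q] from [p]; for [z] in [p] it is arbitrary. *)
have /choice[t tP] z : exists t : spec R * R * R, z \notin p ->
    [/\ minimal_over E t.1.1, z * t.1.2 \notin t.1.1, t.2 \notin p &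
      forall k, minimal_over E k -> t.1.2 * t.2 \in k].
  have [zp|] := boolP (z \in p); first by exists (p, 0, 0).
  move=> zp; have /not_andP[//|/existsNP[q]] := nisol z.
  move=> /not_implyP[Mq /not_implyP[qp /negP zq]].
  have [y [w [yq wp yw]]] := minimal_over_separated Mp Mq (nesym qp).
  exists (q, y, w) => _; split=> //=.
  by rewrite specM negb_or zq.
(* [z n] is the product of the first [n] elements [w]; it stays outside [p], so the choice can be
   repeated. *)
pose z n := iter n (fun u => u * (t u).2) 1.
have zS n : z n.+1 = z n * (t (z n)).2 by [].
have zp n : z n \notin p.
  elim: n => [|n IHn]; first exact: spec1.
  by have [_ _ tp _] := tP _ IHn; rewrite zS specM negb_or IHn.
have z_dvd m n : (m <= n)%N -> exists c, z n = z m * c.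
  move=> /subnKC <-; elim: (n - m)%N => [|d [c zc]].
    by exists 1; rewrite addn0 mulr1.
  by exists (c * (t (z (m + d)%N)).2); rewrite addnS zS mulrA -zc.
pose x n := z n * (t (z n)).1.2.
have xx m n k : (m < n)%N -> minimal_over E k -> x m * x n \in k.
  (* [x m] has the factor [y] of stage [m], and [x n], through [z m.+1], the factor [w] of that
     stage. *)
  move=> /z_dvd[c zc] Mk; have [_ _ _ /(_ k Mk) yw] := tP _ (zp m).
  rewrite /x zc zS !specM; move: yw; rewrite specM.
  by case/orP=> ->; rewrite ?orbT.
have Mq n : minimal_over E (t (z n)).1.1 by have [] := tP _ (zp n).
apply: (@no_orthogonal_sequence x (fun n => (t (z n)).1.1)) => [n|m n k /eqP].
  by have [] := tP _ (zp n).
by rewrite neq_ltn => /orP[]; [|rewrite mulrC]; move=> /xx; apply.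
Qed.

Hypothesis Rdim : finite_krull_dim R.

(** A strict descent from [q] through primes containing [E] stops, by finite dimension. *)
Lemma ex_minimal_over E q : zariski_closed E q ->
  exists2 p, minimal_over E p & {subset p <= q}.
Proof.
elim/(no_sequence_ind (r := fun p q => spec_lt q p)
  (no_descending_primes Rdim)): q => q IH Eq.
have [Mq|/not_andP[//|/existsNP[p]]] := pselect (minimal_over E q).
  by exists q.
move=> /not_implyP[Ep /not_implyP[pq npq]].
have [|//|r Mr rp] := IH p; last by exists r => // x /rp/pq.
split=> // qp; apply: npq; apply/spec_eqP => x.
by apply/idP/idP => [/pq|/qp].
Qed.

Lemma finite_irreducible_cover E : exists ps : seq (spec R),
  (forall p, p \in ps -> zariski_closed E p) /\
  forall q, zariski_closed E q -> exists2 p, p \in ps & {subset p <= q}.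
Proof.
have /finite_seqP[ps psE] := finite_minimal_over E.
have inps p : (p \in ps) <-> minimal_over E p by rewrite psE.
exists ps; split=> [p /inps[]//|q /ex_minimal_over[p Mp pq]].
by exists p => //; exact/inps.
Qed.

End WeaklyLaskerian.

(** * Noetherian spectra and finite generation up to radicals *)

(** Equivalently, some finite subset of [E] generates an ideal with the same radical as the ideal
    generated by [E]. *)
Definition radically_finite (R : comNzRingType) (E : set R) :=
  exists s : seq R, [set` s] `<=` E /\
    zariski_closed [set` s] `<=` zariski_closed E.

Definition spec_noetherian (R : comNzRingType) :=
  forall E : set R, radically_finite E.

(** The complement of the union of the [U n] is cut out by finitely many elements of the [E n], and
    the stages at which these occur have a common bound. *)
Lemma spec_noetherian_space (R : comNzRingType) :
  spec_noetherian R -> noetherian_space (spec R).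
Proof.
move=> Rnoeth U Uopen UU.
have /choice[E UE] n : exists E, U n = ~` zariski_closed E by exact: Uopen.
have [s [sE Vs]] := Rnoeth (\bigcup_n E n).
have Umono : {homo U : m n / (m <= n)%N >-> m `<=` n}.
  exact: (homo_leq (@subset_refl _) (fun _ _ _ => @subset_trans _ _ _ _) UU).
have [m Um] : exists m, ~` zariski_closed [set` s] `<=` U m.
  elim: s sE {Vs} => [_|x s IH sE].
    by exists 0%N => p; apply: contra_notP.
  have [|m Um] := IH; first by move=> y ys; apply: sE; rewrite /= inE ys orbT.
  have [n _ Ex] : (\bigcup_n E n) x by apply: sE; rewrite /= inE eqxx.
  exists (maxn m n) => p nVp; have [xp|xp] := boolP (x \in p).
    apply: (Umono m); first exact: leq_maxl.
    apply: Um => sp; apply: nVp => y /=; rewrite inE => /predU1P[->//|].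
    exact: sp.
  apply: (Umono n); first exact: leq_maxr.
  by rewrite UE => /(_ x Ex); exact/negP.
exists m => i mi; apply/seteqP; split; last exact: Umono.
move=> p; rewrite UE => nVp; apply: Um => /Vs Vp.
by apply: nVp => x Ex; apply: Vp; exists i.
Qed.

Lemma weakly_laskerian_spec_noetherian (R : comNzRingType) :
  weakly_laskerian_ring R -> finite_krull_dim R -> spec_noetherian R.
Proof.
move=> RwL Rdim E.
(* If each [V(E) :&: V(p)], for [p] in [ps], is cut out by finitely many elements
   of [E], then so is the union of these sets. *)
have cover (ps : seq (spec R)) : (forall p, p \in ps -> exists s : seq R,
      [set` s] `<=` E /\ forall q : spec R, {subset p <= q} ->
        zariski_closed [set` s] q -> zariski_closed E q) ->
    exists s : seq R, [set` s] `<=` E /\ forall p q : spec R, p \in ps ->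
      {subset p <= q} -> zariski_closed [set` s] q -> zariski_closed E q.
  elim: ps => [_|p ps IH psP]; first by exists [::].
  have [|s [sE sP]] := IH; first by move=> q qps; apply: psP; rewrite inE qps orbT.
  have [|t [tE tP]] := psP p; first by rewrite inE eqxx.
  exists (s ++ t); split=> [x /=|q r].
    by rewrite mem_cat => /orP[/sE|/tE].
  rewrite inE => /predU1P[->|qps] qr Vr.
    by apply: tP => // x /= xt; apply: Vr; rewrite /= mem_cat xt orbT.
  by apply: (sP q) => // x /= xs; apply: Vr; rewrite /= mem_cat xs.
have Vp (p : spec R) : exists s : seq R, [set` s] `<=` E /\
    forall q : spec R, {subset p <= q} -> zariski_closed [set` s] q -> zariski_closed E q.
  elim/(no_sequence_ind (r := @spec_lt R)
    (no_ascending_primes Rdim)): p => p IH.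
  have [Ep|/existsNP[x /not_implyP[Ex /negP xp]]] := pselect (zariski_closed E p).
    by exists [::]; split=> // q pq _ x /Ep; exact: pq.
  (* As [x] is in [E] but not in [p], the primes [ps] are strictly larger than [p] and fall under
     the induction hypothesis; adding [x] to their elements confines [V(p)] to their union. *)
  have [ps [psP cov]] :=
    finite_irreducible_cover RwL Rdim ([set` p] `|` [set x]).
  have [q /psP Vq|s [sE sP]] := cover ps.
    apply: IH; split=> [y py|]; first by apply: Vq; left.
    by move=> /(_ x) qp; move/negP: xp; apply; apply: qp; apply: Vq; right.
  exists (x :: s); split=> [y /=|q pq Vq].
    by rewrite inE => /predU1P[->//|/sE].
  have [y [py|->]|r rps rq] := cov q; first exact: pq.
    by apply: Vq; rewrite /= inE eqxx.
  apply: (sP r) => // y /= ys; apply: Vq.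
  by rewrite /= inE ys orbT.
(* For the empty set the cover is one of the whole spectrum. *)
have [ps [_ cov]] := finite_irreducible_cover RwL Rdim set0.
have [p _|s [sE sP]] := cover ps; first exact: Vp.
exists s; split=> // q Vq; have [//|p pps pq] := cov q.
exact: (sP p).
Qed.

(** This is the chain condition for Zorn's lemma, in contrapositive form: the finite set [s] already
    lies in one member of the chain. *)
Lemma radically_finite_bigcup (R : comNzRingType) (F : set (set R)) :
  F !=set0 -> total_on F subset -> radically_finite (\bigcup_(X in F) X) ->
  exists2 X, F X & radically_finite X.
Proof.
move=> F0 Ftot [s [sF Vs]]; have [X FX sX] := chain_seq_sub F0 Ftot sF.
exists X => //; exists s; split=> // p /Vs Vp x Xx.
by apply: Vp; exists X.
Qed.

Lemma radically_finite_setU1 (R : comNzRingType) (Q : set R) (x : R) :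
  radically_finite (x |` Q) ->
  exists s : seq R, [set` s] `<=` Q /\ forall p : spec R,
    zariski_closed [set` s] p -> x \in p -> zariski_closed Q p.
Proof.
move=> [s [sQ Vs]]; exists [seq y <- s | `[< Q y >]]; split=> [y /=|p Vp xp y Qy].
  by rewrite mem_filter => /andP[/asboolP].
apply: (Vs p); last by right.
move=> z zs; have [->//|Qz] := sQ z zs.
by apply: Vp; rewrite /= mem_filter; apply/andP; split=> //; exact/asboolP.
Qed.

(** As in Cohen's theorem, maximality forces primeness; Zorn's lemma runs over arbitrary subsets,
    and maximality also makes [Q] an ideal. *)
Lemma ex_maximal_not_radically_finite (R : comNzRingType) :
  ~ spec_noetherian R -> exists Q : spec R,
    ~ radically_finite [set` Q] /\ forall x, x \notin Q ->
      exists s : seq R, [set` s] `<=` [set` Q] /\ forall p : spec R,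
        zariski_closed [set` s] p -> x \in p -> zariski_closed [set` Q] p.
Proof.
move=> /existsNP[E nE].
have [|Q [_ nQ maxQ]] := @Zorn_above _ [set E : set R | ~ radically_finite E] E nE.
  move=> F FN F0 Ftot /(radically_finite_bigcup F0 Ftot)[X FX].
  exact: FN.
have gen x : ~ Q x -> exists s : seq R, [set` s] `<=` Q /\
    forall p : spec R, zariski_closed [set` s] p -> x \in p -> zariski_closed Q p.
  move=> nQx; apply: radically_finite_setU1; apply: contrapT; apply: maxQ.
  by split=> [y Qy|sub]; [right|apply/nQx/sub; left].
(* If such an [x] were outside [Q], the elements given by [gen] together with [s] would make [Q]
   radically finite. *)
have in_span x (s : seq R) : [set` s] `<=` Q ->
    (forall p, zariski_closed [set` s] p -> x \in p) -> Q x.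
  move=> sQ sx; apply: contrapT => /gen[t [tQ Vt]]; apply: nQ.
  exists (s ++ t); split=> [y /=|p Vp]; first by rewrite mem_cat => /orP[/sQ|/tQ].
  apply: Vt => [y /= yt|]; first by apply: Vp; rewrite /= mem_cat yt orbT.
  by apply: sx => y /= ys; apply: Vp; rewrite /= mem_cat ys.
have [|||||q qE] := @ex_spec R Q.
- by apply: (in_span _ [::]) => // p _; exact: spec0.
- move=> Q1; apply: nQ; exists [:: 1]; split=> [y /=|p Vp].
    by rewrite inE => /eqP->.
  by have := Vp 1; rewrite /= inE eqxx => /(_ isT) /negPn; rewrite spec1.
- move=> x y Qx Qy; apply: (in_span _ [:: x; y]) => [z /=|p Vp].
    by rewrite !inE => /orP[]/eqP->.
  by apply: specD; apply: Vp; rewrite /= !inE eqxx ?orbT.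
- move=> a x Qx; apply: (in_span _ [:: x]) => [z /=|p Vp].
    by rewrite inE => /eqP->.
  by apply: specMl; apply: Vp; rewrite /= inE.
(* A prime containing [x * y] contains [x] or [y], and then [s] or [t] forces it to contain [Q]. *)
- move=> x y Qxy; apply: contrapT => /not_orP[/gen[s [sQ Vs]] /gen[t [tQ Vt]]].
  apply: nQ; exists (x * y :: s ++ t); split=> [z /=|p Vp].
    by rewrite inE mem_cat => /or3P[/eqP->|/sQ|/tQ].
  have : x * y \in p by apply: Vp; rewrite /= inE eqxx.
  rewrite specM => /orP[xp|yp].
    by apply: Vs => // z /= zs; apply: Vp; rewrite /= inE mem_cat zs orbT.
  by apply: Vt => // z /= zt; apply: Vp; rewrite /= inE mem_cat zt !orbT.
have QE : [set` q] = Q by apply/seteqP; split=> x /=; rewrite qE.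
exists q; rewrite QE; split=> // x /negP; rewrite qE; exact: gen.
Qed.

(** * Ring maps and polynomials in one indeterminate *)

Lemma spec_comap (A B : comNzRingType) (f : {rmorphism A -> B}) (p : spec B) :
  exists q : spec A, forall x, (x \in q) = (f x \in p).
Proof.
have [|||||q qE] := @ex_spec A [set x | f x \in p].
- by rewrite /= rmorph0 spec0.
- by rewrite /= rmorph1; apply/negP/spec1.
- by move=> x y /= fx fy; rewrite rmorphD specD.
- by move=> a x /= fx; rewrite rmorphM specMl.
- by move=> x y; rewrite /= rmorphM specM => /orP.
by exists q => x; apply/idP/idP => /qE.
Qed.

Lemma spec_noetherian_surj (A B : comNzRingType) (f : {rmorphism A -> B}) :
  (forall b, exists a, f a = b) -> spec_noetherian A -> spec_noetherian B.
Proof.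
move=> /choice[g gK] Anoeth E; have [s [sE Vs]] := Anoeth (f @^-1` E).
exists [seq f a | a <- s]; split=> [_ /mapP[a as_ ->]|p Vp x Ex].
  exact: sE.
have [q qE] := spec_comap f p.
rewrite -(gK x) -qE; apply: (Vs q) => [a as_|]; last by rewrite /= gK.
by rewrite qE; apply: Vp; exact: map_f.
Qed.

Lemma spec_poly_coef (R : comNzRingType) (P : spec {poly R}) (f : {poly R}) :
  (forall i, (f`_i)%:P \in P) -> f \in P.
Proof.
move=> fP; rewrite -[f]coefK poly_def; apply: spec_sum => i _.
by rewrite -mul_polyC; exact: specMr.
Qed.

(* Hilbert's argument applied to a prime [Q] maximal among the ideals that are
   not radically finite; [f] is an element of [Q] of least degree outside
   [(Q \cap R)[X]] and [a] its leading coefficient. A prime that contains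
   [Q \cap R] and [f] but not [a] contains [Q], by pseudo-division by [f]; primes
   that contain [a] are dealt with by maximality. *)
Lemma spec_noetherian_poly (R : comNzRingType) :
  spec_noetherian R -> spec_noetherian {poly R}.
Proof.
move=> Rnoeth; apply: contrapT => /ex_maximal_not_radically_finite[Q [nQ gen]].
apply: nQ; have [s [sQ Vs]] := Rnoeth [set c | c%:P \in Q].
have VsC (P : spec {poly R}) : zariski_closed [set c%:P | c in [set` s]] P ->
    forall c, c%:P \in Q -> c%:P \in P.
  move=> VP c cQ; have [q qE] := spec_comap (@polyC R) P.
  rewrite -qE; apply: (Vs q) => // b bs; rewrite qE.
  by apply: VP; exists b.
have sCQ : [set` map polyC s] `<=` [set` Q].
  by move=> _ /mapP[c cs ->]; exact: sQ.
(* If [Q] contains the coefficients of all its elements, its constants generate it, and [s]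
   suffices. *)
have [allQ|] := pselect (forall g, g \in Q -> forall i, (g`_i)%:P \in Q).
  exists (map polyC s); split=> // P VP g gQ; apply: spec_poly_coef => i.
  by apply: VsC; [move=> _ [c cs <-]; apply: VP; exact: map_f|exact: allQ].
move=> /existsNP[g0 /not_implyP[g0Q /existsNP[i0 g0i]]].
pose bad n := `[< exists g,
  [/\ g \in Q, size g = n & exists i, (g`_i)%:P \notin Q] >].
have exbad : exists n, bad n.
  by exists (size g0); apply/asboolP; exists g0; split=> //; exists i0; exact/negP.
have [n /asboolP[f [fQ fn [i fi]]] nmin] := ex_minnP exbad.
have small g : g \in Q -> (size g < size f)%N -> forall j, (g`_j)%:P \in Q.
  move=> gQ gf j; apply: contraLR gf => gj; rewrite -leqNgt fn; apply: nmin.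
  by apply/asboolP; exists g; split=> //; exists j.
have f0 : f != 0.
  by apply: contraNneq fi => ->; rewrite coef0 spec0.
(* Otherwise [f] minus its leading term is in [Q] and has smaller size, so all coefficients of [f]
   are in [Q]. *)
have aQ : (lead_coef f)%:P \notin Q.
  apply/negP => aQ; case/negP: fi.
  pose g := f - (lead_coef f)%:P * 'X^((size f).-1).
  have gQ : g \in Q by apply: specB => //; exact: specMr.
  have -> : f = g + (lead_coef f)%:P * 'X^((size f).-1) by rewrite subrK.
  rewrite coefD coefCM polyCD polyCM; apply: specD; last exact: specMr.
  apply: small => //; rewrite -[X in (_ < X)%N](prednK (n := size f)).
    rewrite ltnS; apply/leq_sizeP => j; rewrite leq_eqVlt => /predU1P[<-|fj].
      by rewrite coefB coefCM coefXn eqxx mulr1 subrr.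
    rewrite coefB coefCM coefXn gtn_eqF // mulr0 subr0 nth_default //.
    by rewrite -ltnS prednK ?size_poly_gt0 // in fj.
  by rewrite size_poly_gt0.
have [t [tQ Vt]] := gen _ aQ.
exists (f :: map polyC s ++ t); split=> [x /=|P VP].
  by rewrite inE mem_cat => /or3P[/eqP->//|/sCQ|/tQ].
have fP : f \in P by apply: VP; rewrite /= inE eqxx.
have [aP|aP] := boolP ((lead_coef f)%:P \in P).
  by apply: Vt => // x /= xt; apply: VP; rewrite /= inE mem_cat xt !orbT.
move=> g gQ; pose k := Pdiv.Ring.rscalp g f.
have divE : g * (lead_coef f ^+ k)%:P =
    Pdiv.Ring.rdivp g f * f + Pdiv.Ring.rmodp g f.
  by apply: Pdiv.RingComRreg.rdivp_eq; exact: mulrC.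
have rQ : Pdiv.Ring.rmodp g f \in Q.
  have -> : Pdiv.Ring.rmodp g f =
      g * (lead_coef f ^+ k)%:P - Pdiv.Ring.rdivp g f * f.
    by rewrite divE addrAC subrr add0r.
  by apply: specB; [exact: specMr|exact: specMl].
(* The remainder is smaller than [f], so by minimality its coefficients are in [Q], hence in [P]. *)
have rP : Pdiv.Ring.rmodp g f \in P.
  apply: spec_poly_coef => j; apply: VsC => [_ [c cs <-]|].
    by apply: VP; rewrite /= inE mem_cat (map_f polyC cs) orbT.
  by apply: small => //; exact: Pdiv.Ring.ltn_rmodpN0.
have : g * (lead_coef f ^+ k)%:P \in P.
  by rewrite divE; apply: specD => //; exact: specMl.
rewrite specM => /orP[//|]; elim: k {divE} => [|k IHk].
  by rewrite expr0 (negPf (spec1 P)).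
by rewrite exprS polyCM specM (negPf aP).
Qed.

(** * Polynomials in several indeterminates *)

Lemma mpoly0_surj (R : comNzRingType) (p : mpoly 0 R) :
  exists c : R, mpolyC 0 c = p.
Proof.
elim/mpolyind: p => [|c m p _ _ [d <-]]; first by exists 0; exact: mpolyC0.
exists (c + d); rewrite mpolyCD; congr (_ + _).
have -> : m = mnm0 by apply/mnmP => -[].
by rewrite mpolyX0 alg_mpolyC.
Qed.

(** Evaluation at the last indeterminate reaches every monomial, one factor at a time; the other
    indeterminates come from the coefficients. *)
Lemma mpolyS_surj (R : comNzRingType) (n : nat) (p : mpoly n.+1 R) :
  exists q : {poly mpoly n R},
    (map_poly (@mwiden n R) q).[mpolyX R (mnm1 ord_max)] = p.
Proof.
pose ev (q : {poly mpoly n R}) :=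
  horner_eval (mpolyX R (mnm1 (@ord_max n))) (map_poly (@mwiden n R) q).
have evM q q' : ev (q * q') = ev q * ev q' by rewrite /ev !rmorphM.
have evD q q' : ev (q + q') = ev q + ev q' by rewrite /ev !raddfD.
have evC q : ev q%:P = mwiden q by rewrite /ev /= map_polyC /= /horner_eval hornerC.
have evX m : exists q, ev q = mpolyX R m.
  rewrite mpolyXE_id; elim/big_ind: _ => [|_ _ [q <-] [q' <-]|i _].
  - by exists 1; rewrite /ev !rmorph1.
  - by exists (q * q').
  - elim: (m i) => [|k [q qE]]; first by exists 1; rewrite /ev !rmorph1.
    rewrite exprS -qE; have [->|] := eqVneq i ord_max.
      by exists ('X * q); rewrite evM; congr (_ * _);
        rewrite /ev /= map_polyX /horner_eval hornerX.
    rewrite -(inj_eq val_inj) /= => ni.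
    have lin : (i < n)%N by rewrite ltn_neqAle ni -ltnS ltn_ord.
    exists ((mpolyX R (mnm1 (Ordinal lin)))%:P * q); rewrite evM evC.
    by rewrite mwidenX mnmwiden1; congr (mpolyX _ (mnm1 _) * _); exact: val_inj.
elim/mpolyind: p => [|c m p _ _ [q <-]].
  by exists 0; rewrite -[LHS]/(ev 0) /ev !raddf0.
have [q' q'E] := evX m; exists ((mpolyC n c)%:P * q' + q).
by rewrite -[LHS]/(ev _) evD evM evC mwidenC q'E mul_mpolyC.
Qed.

Lemma spec_noetherian_mpoly (R : comNzRingType) (n : nat) :
  spec_noetherian R -> spec_noetherian (mpoly n R).
Proof.
move=> Rnoeth; elim: n => [|n IHn].
  exact: (spec_noetherian_surj (f := @mpolyC 0 R) (@mpoly0_surj R)).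
pose ev : {rmorphism {poly mpoly n R} -> mpoly n.+1 R} :=
  horner_eval (mpolyX R (mnm1 (@ord_max n))) \o map_poly (@mwiden n R).
apply: (spec_noetherian_surj (f := ev)); first exact: mpolyS_surj.
exact: spec_noetherian_poly.
Qed.

Theorem corollary2p5 (R : comNzRingType) :
  weakly_laskerian_ring R -> finite_krull_dim R ->
  noetherian_space (spec R) /\
  (forall n : nat, noetherian_space (spec (mpoly n R))).
Proof.
move=> RwL Rdim.
have Rnoeth := weakly_laskerian_spec_noetherian RwL Rdim.
split=> [|n]; first exact: spec_noetherian_space.
by apply: spec_noetherian_space; exact: spec_noetherian_mpoly.
Qed.
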